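(* Let $\mathbb{A}=\{a_n : n\in\mathbb{N}\}\subseteq\mathbb{R}$ be a real sequence belonging to the class (A), i.e. $a_0=0$, $a_{n+1}-a_n\ge 1$ for every $n\in\mathbb{N}$, and $\log a_n=o(n)$ as $n\to\infty$. Let $\phi:\mathbb{N}\times(0,+\infty)\to(0,+\infty)$ be such that for each $n$ the function $t\mapsto\phi(n,t)$ is increasing, and such that there are constants $C_1,C_2>0$ with $$C_1t\le\phi(n+1,t)\,a_{n+1}-\phi(n,t)\,a_n\qquad\text{and}\qquad \phi(n,t)\le C_2t$$ for all $n\in\mathbb{N}$ and all $t>0$. Then for each $0\le p<1$ there exists a Lebesgue measurable set $E\subseteq\mathbb{R}$ such that $E$ intersects every interval of unit length in a set of Lebesgue measure at least $p$, but $E$ does not contain the set $$\{x+\phi(n,t)\cdot a_n: n\in\mathbb{N}\}$$ for any choice of $x\in\mathbb{R}$, $t>0$.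
   Context: $\mathbb{N}=\{0,1,2,\dots\}$. A real sequence $(a_n)_{n\in\mathbb{N}}$ is in the class (A) if (1) $a_0=0$, (2) $a_{n+1}-a_n\ge1$ for every $n\in\mathbb{N}$, and (3) $\log a_n=o(n)$, i.e. $\frac{\log a_n}{n}\to0$ as $n\to\infty$. *)

(* Defs.v *)
From mathcomp Require Import all_boot all_order all_algebra.
From mathcomp Require Import all_classical all_reals all_analysis.
Set Implicit Arguments.
Unset Strict Implicit.
Unset Printing Implicit Defensive.
Import Order.TTheory GRing.Theory Num.Theory.
Import numFieldNormedType.Exports.
Local Open Scope classical_set_scope.
Local Open Scope ring_scope.

(* The term of the quotient at n = 0 is ln 0 / 0 = 0 by the library's total
   conventions; it plays no role in the limit. *)
Definition classA (R : realType) (a : nat -> R) : Prop :=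
  [/\ a 0%N = 0,
      (forall n : nat, 1 <= a n.+1 - a n) &
      (fun n : nat => ln (a n) / n%:R) @ \oo --> (0 : R)].

(* [measurable] on R is Borel measurability; the Lebesgue measurable sets are
   the Caratheodory measurable sets of the Lebesgue outer measure, i.e. the
   sigma-algebra on which [completed_lebesgue_measure] is a measure (see
   [completed_caratheodory_measurable]). *)
Definition lebesgue_measurable (R : realType) (E : set R) : Prop :=
  ((wlength (idfun : R -> R))^*)%mu.-cara.-measurable E.

(* Main.v *)
(** Put b_n(t) = phi(n,t) a_n.  It suffices to find, for each integer m and each
    compact range of t, a set F of small measure in every unit interval meeting
    every {x + b_n(t)} with x in [m, m+1[: as there are countably many such
    pairs, the complement of the union of these F works.

    To build F, cut the line into blocks shorter than the gaps of b_n(t), each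
    made of K cells of length d, and select one cell per block at random.  For a
    fixed sequence of cells (one for each n < N), the gaps make the N selections
    independent, so that it is missed with probability (1 - 1/K)^N.  Only
    O(N a_N) sequences of cells arise: b_n is monotone in t, so the cells of
    (b_n(t))_(n < N) are determined by the sum of their indices, and x is only
    needed up to d, provided that each selected cell is enlarged by the next
    one.  Since log a_N = o(N), the union bound succeeds for some N. *)
Require Import Defs.
From mathcomp Require Import all_boot all_order all_algebra.
From mathcomp Require Import all_classical all_reals all_analysis.
From mathcomp Require Import ring lra zify.

(** * Choosing one cell per block *)

(* Union bound over [I], by counting the [f] that miss a given [c i]. *)
Lemma exists_hitting_choice (I : finType) (k N : nat) (c : I -> nat -> nat) :
  (forall i n, (c i n + k.+1 <= c i n.+1)%N) ->
  (#|I| * k ^ N < k.+1 ^ N)%N ->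
  exists2 f : nat -> nat, forall b, (f b < k.+1)%N &
    forall i, exists2 n, (n < N)%N & (c i n %% k.+1 = f (c i n %/ k.+1))%N.
Proof.
move=> c_gap fewI.
pose blk i n := (c i n %/ k.+1)%N.
have blk_mono i : {homo blk i : m n / (m < n)%N}.
  apply: (homo_ltn ltn_trans) => n.
  rewrite /blk -addn1 -[X in (_ + X)%N](divnn k.+1) -divnDr //.
  exact: leq_div2r.
have blk_inj i m n : blk i m = blk i n -> m = n.
  move=> e; case: (ltngtP m n) => // /(blk_mono i); rewrite e ltnn //.
(* Finitely many blocks suffice. The summand [N] gives [N <= B], needed for the exponent [B - N];
   the successor makes ['I_B] inhabited and the bound strict. *)
pose B := (N + \max_i \max_(n < N) blk i n).+1.
have blk_lt i n : (n < N)%N -> (blk i n < B)%N.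
  move=> nN; rewrite ltnS (leq_trans _ (leq_addl _ _)) // (leq_trans _ (leq_bigmax i)) //.
  exact: (leq_bigmax (Ordinal nN)).
pose cell i n : 'I_k.+1 := inord (c i n %% k.+1).
pose F i (b : 'I_B) : pred 'I_k.+1 :=
  [pred r | [forall n : 'I_N, (blk i n == b) ==> (r != cell i n)]].
pose avoid i := [set f : {ffun 'I_B -> 'I_k.+1} | f \in family (F i)].
have card_avoid i : (#|avoid i| <= k ^ N * k.+1 ^ (B - N))%N.
  (* The [N] blocks visited are distinct, and each of them forbids at least one cell: at most [k]
     choices remain there, [k.+1] elsewhere. *)
  pose A := [set (inord (blk i (n : 'I_N)) : 'I_B) | n in 'I_N].
  have cardA : #|A| = N.
    rewrite card_in_imset ?card_ord // => m n _ _ /(congr1 val).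
    rewrite /= !inordK ?blk_lt // => /blk_inj; exact: val_inj.
  rewrite cardsE card_family foldrE big_map big_enum /=.
  rewrite (bigID (mem A)) /=; apply: leq_mul.
    rewrite -[X in (_ <= k ^ X)%N]cardA -prod_nat_const; apply: leq_prod => b.
    case/imsetP => n _ ->.
    rewrite -ltnS -[X in (_ < X)%N](card_ord k.+1).
    apply: proper_card; apply/properP; split; first by apply/fintype.subsetP.
    exists (cell i n) => //; apply/negP => /forallP/(_ n).
    by rewrite inordK ?blk_lt // !eqxx.
  have -> : (B - N)%N = #|[predC A]|.
    have := cardC (mem A); rewrite cardA card_ord => e.
    by rewrite -[in LHS]e addKn; apply: eq_card.
  rewrite -prod_nat_const; apply: leq_prod => b _.
  by rewrite -[X in (_ <= X)%N](card_ord k.+1) max_card.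
have [f f_hits] : exists f, f \notin \bigcup_i avoid i.
  apply/existsP; rewrite -[X in is_true X]negbK negb_exists; apply/negP => /forallP H.
  have full : (#|{: {ffun 'I_B -> 'I_k.+1}}| <= #|\bigcup_i avoid i|)%N.
    by apply/subset_leq_card/fintype.subsetP => f _; move: (H f); rewrite negbK.
  have : (k.+1 ^ B <= #|I| * (k ^ N * k.+1 ^ (B - N)))%N.
    move: full; rewrite card_ffun !card_ord => /leq_trans; apply.
    apply: (@leq_trans (\sum_i #|avoid i|)).
      elim/big_ind2: _ => [|A a D d Aa Dd|//]; first by rewrite cards0.
      by rewrite (leq_trans (leq_card_setU _ _).1) // leq_add.
    rewrite -sum_nat_const; exact: leq_sum.
  rewrite leqNgt => /negP; apply.
  have NB : (N <= B)%N by rewrite ltnW // ltnS leq_addr.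
  by rewrite mulnA -{2}(subnKC NB) expnD ltn_pmul2r // expn_gt0.
exists (fun b => f (inord b) : nat) => [b|i]; first exact: ltn_ord.
apply: contrapT => hit; move/negP: f_hits; apply.
apply/finset.bigcupP; exists i => //; rewrite inE; apply/familyP => b.
apply/forallP => n; apply/implyP => /eqP eb; apply/negP => /eqP ef.
apply: hit; exists n => //.
by rewrite -/(blk i n) eb inord_val ef inordK // ltn_pmod.
Qed.

Import Order.TTheory GRing.Theory Num.Theory.
Import numFieldNormedType.Exports.
Local Open Scope classical_set_scope.
Local Open Scope ring_scope.

(** * Growth of sequences in class (A) *)

Lemma classA_ge_nat (R : realType) (a : nat -> R) (n : nat) :
  classA a -> n%:R <= a n.
Proof.
case=> a0 gap _; elim: n => [|n IHn]; first by rewrite a0.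
by have := gap n; rewrite -natr1; lra.
Qed.

(* Both [n] and [a n] are [O(exp (eta n))] for every [eta > 0], so the left-hand
   side is [O(exp (2 eta n))], which is less than [r ^+ n] if [3 eta = ln r]. *)
Lemma classA_growth (R : realType) (a : nat -> R) (C r : R) :
  classA a -> 0 <= C -> 1 < r ->
  exists n : nat, C * (n%:R * a n + 1) < r ^+ n.
Proof.
move=> aA C0 r1; have [_ _ lna] := aA.
pose eta := ln r / 3.
have eta0 : 0 < eta by rewrite divr_gt0 // ln_gt0.
have /cvgrPdist_lt/(_ _ eta0) small := lna.
near \oo => n; exists n.
have n0 : (0 < n)%N by near: n; exists 1%N.
have nR : 0 < n%:R :> R by rewrite ltr0n.
have an0 : 0 < a n by rewrite (lt_le_trans nR) // classA_ge_nat.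
pose X := expR (eta * n%:R).
have X1 : 1 <= X by rewrite -expR0 ler_expR mulr_ge0 // ltW.
have aX : a n <= X.
  rewrite -[leLHS]lnK // ler_expR -ler_pdivrMr //.
  have : `|0 - ln (a n) / n%:R| < eta by near: n.
  by rewrite sub0r normrN => /ltW; apply: le_trans; exact: ler_norm.
have nX : n%:R * eta <= X.
  by have := @expR_ge1Dx R (eta * n%:R); rewrite -/X; lra.
(* Two factors of [X ^+ 3] bound [n%:R * a n]; the third absorbs the constant. *)
have CX : C * (eta^-1 + 1) < X.
  have h : C * (eta^-1 + 1) / eta < n%:R.
    by near: n; exact: nbhs_infty_gtr.
  by rewrite (lt_le_trans _ nX) // -ltr_pdivrMr.
have -> : r ^+ n = X ^+ 3.
  rewrite -[in LHS](@lnK _ r) ?posrE; last by lra.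
  by rewrite -!expRM_natl; congr expR; rewrite /eta; field.
apply: (@le_lt_trans _ _ (C * (eta^-1 + 1) * X ^+ 2)); last first.
  by rewrite [ltRHS]exprS ltr_pM2r // exprn_gt0 // expR_gt0.
rewrite -mulrA ler_wpM2l // mulrDl mul1r lerD //.
  have nX' : n%:R <= eta^-1 * X by rewrite mulrC ler_pdivlMr.
  by rewrite expr2 mulrA; apply: ler_pM => //; exact: ltW.
exact: exprn_ege1.
Unshelve. all: by end_near.
Qed.

(** * The selected cells and their density *)

(* Two cells per block: the starting point [x] is rounded down to a multiple of
   the cell length, which may shift a point by one cell. *)
Definition block_cells {R : realType} (k l : nat) (f : nat -> nat) (m : R) :
    set R :=
  \bigcup_b ([set` `[m + (b * k.+1 + f b)%:R / (k.+1 * l.+1)%:R,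
                     m + (b * k.+1 + f b).+2%:R / (k.+1 * l.+1)%:R[]).

Lemma measurable_block_cells (R : realType) (k l : nat) (f : nat -> nat)
  (m : R) : measurable (block_cells k l f m).
Proof. by apply: bigcupT_measurable => b; exact: measurable_itv. Qed.

(** Blocks have length [l.+1%:R^-1], so at most [l + 4] of the selected pieces meet a unit interval.
    Each has measure [2 / (k.+1 * l.+1)], and [l + 4 <= 4 * l.+1] makes the bound independent of
    [l]. *)
Lemma block_cells_measure (R : realType) (k l : nat) (f : nat -> nat)
    (m u : R) : (forall b, (f b < k.+1)%N) ->
  (lebesgue_measure (block_cells k l f m `&` [set` `[u, (u + 1)%R]]) <=
    (8 / k.+1%:R)%:E)%E.
Proof.
move=> f_lt; pose q : R := (k.+1 * l.+1)%:R.
have q0 : 0 < q by rewrite ltr0n.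
pose P b : set R := [set` `[m + (b * k.+1 + f b)%:R / q,
              m + (b * k.+1 + f b).+2%:R / q[].
(* First block that can matter. The [2] is there because the second cell may spill into the next
   block; a negative argument truncates to [0], still a lower bound. *)
pose c := Num.truncn (l.+1%:R * (u - m) - 2).
have muP b : lebesgue_measure (P b) = (2 / q)%:E.
  rewrite lebesgue_measure_itv /= lte_fin ifT; last first.
    by rewrite ltrD2l ltr_pM2r ?invr_gt0 // ltr_nat; lia.
  rewrite -EFinB; congr EFin; rewrite -[in LHS]addn2 natrD; ring.
apply: (@le_trans _ _ (\sum_(i < l + 4) lebesgue_measure (P (c + i)%N))%E).
  apply: (@content_subadditive _ _ _ (@lebesgue_measure R) _ (fun i => P (c + i)%N)).
  - by move=> i _; exact: measurable_itv.
  - apply: measurableI; [exact: measurable_block_cells|exact: measurable_itv].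
  move=> x [[b _]] /=; rewrite !in_itv /= => /andP[bx xb] /andP[ux xu].
  have qE : q = k.+1%:R * l.+1%:R by rewrite /q natrM.
  have k0 : 0 < k.+1%:R :> R by rewrite ltr0n.
  have l0 : 0 < l.+1%:R :> R by rewrite ltr0n.
  have fb : ((f b).+1)%:R <= k.+1%:R :> R by rewrite ler_nat.
  have k1 : 1 <= k.+1%:R :> R by rewrite ler1n.
  have lo : b%:R <= l.+1%:R * (x - m).
    rewrite -(ler_pM2l k0) mulrA -qE mulrC.
    have : (b * k.+1 + f b)%:R <= (x - m) * q.
      by rewrite -ler_pdivrMr // lerBrDl.
    rewrite natrD natrM; have : 0 <= (f b)%:R :> R by [].
    lra.
  have hi : l.+1%:R * (x - m) < b%:R + 2.
    rewrite -(ltr_pM2l k0) mulrA -qE mulrC.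
    have : (x - m) * q < (b * k.+1 + f b).+2%:R.
      by rewrite -ltr_pdivlMr // ltrBlDl.
    rewrite -!natr1 natrD natrM -natr1; nra.
  have cb : (c <= b)%N.
    rewrite truncn_le_nat -natr1.
    have : l.+1%:R * (u - m) <= l.+1%:R * (x - m) by rewrite ler_pM2l // lerB.
    lra.
  have bc : (b - c < l + 4)%N.
    rewrite -(ltr_nat R) natrB // natrD.
    have : l.+1%:R * (x - m) <= l.+1%:R * (u - m) + l.+1%:R.
      by rewrite -[X in _ <= _ + X]mulr1 -mulrDr ler_pM2l //; lra.
    have := truncnS_gt (l.+1%:R * (u - m) - 2); rewrite -/c -!natr1; lra.
  rewrite -(bigcup_mkord (l + 4) (fun i => P (c + i)%N)); exists (b - c)%N => //=.
  by rewrite subnKC // /P /= in_itv /= bx xb.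
under eq_bigr do rewrite muP.
rewrite sumEFin lee_fin sumr_const card_ord -[leLHS]mulr_natl.
rewrite -[leRHS](@mulfK _ l.+1%:R) ?pnatr_eq0 // /q natrM invfM.
have l0 : 0 < l.+1%:R :> R by rewrite ltr0n.
have lE : (l + 4)%:R <= 4 * l.+1%:R :> R by rewrite -natrM ler_nat; lia.
rewrite [leRHS](_ : _ = 4 * l.+1%:R * (2 * (k.+1%:R^-1 * l.+1%:R^-1))).
  by rewrite ler_pM2r // !mulr_gt0 ?invr_gt0 ?ltr0n.
by field; rewrite /= !nat1r !pnatr_eq0.
Qed.

(** * Hitting all translates for a bounded range of parameters *)

Lemma classA_homo (R : realType) (a : nat -> R) :
  classA a -> {homo a : m n / (m <= n)%N >-> m <= n}.
Proof.
case=> _ gap _; apply: homo_leq => [x|y x z|n]; first exact: lexx.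
  exact: le_trans.
by have := gap n; lra.
Qed.

Lemma hitting_block_cells (R : realType) (a : nat -> R) (b : nat -> R -> R)
    (T : set R) (D m : R) (k l : nat) : (0 < k)%N ->
  classA a -> 0 <= D ->
  (forall n t, T t -> 0 <= b n t <= D * a n) ->
  (forall n s t, T s -> T t -> s <= t -> b n s <= b n t) ->
  (forall n t, T t -> l.+1%:R^-1 <= b n.+1 t - b n t) ->
  exists2 f : nat -> nat, forall i, (f i < k.+1)%N &
    forall x t, m <= x < m + 1 -> T t ->
      exists n, block_cells k l f m (x + b n t).
Proof.
move=> k0 aA D0 b_bound b_incr b_gap.
pose q : R := (k.+1 * l.+1)%:R.
have q0 : 0 < q by rewrite ltr0n.
pose cfg t n := Num.truncn (b n t * q).
have bq_ge0 n t : T t -> 0 <= b n t * q.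
  by move=> /(b_bound n)/andP[b0 _]; rewrite mulr_ge0 // ltW.
have cfg_gap t n : T t -> (cfg t n + k.+1 <= cfg t n.+1)%N.
  move=> Tt; rewrite truncn_ge_nat ?bq_ge0 // natrD.
  have : (cfg t n)%:R <= b n t * q by rewrite truncn_le bq_ge0.
  have : k.+1%:R <= (b n.+1 t - b n t) * q.
    rewrite (le_trans _ (ler_wpM2r (ltW q0) (b_gap n t Tt))) //.
    by rewrite /q natrM mulrCA mulVf ?pnatr_eq0 // mulr1.
  lra.
have cfg_incr n s t : T s -> T t -> s <= t -> (cfg s n <= cfg t n)%N.
  by move=> Ts Tt st; rewrite le_truncn // ler_pM2r // b_incr.
have r1 : 1 < k.+1%:R / k%:R :> R.
  by rewrite ltr_pdivlMr ?ltr0n // mul1r ltr_nat.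
(* There will be [q] starting cells and at most [N * (D * a N * q) + 1] totals; their product is at
   most this constant times [N%:R * a N + 1]. *)
have C0 : 0 <= q * (D * q + 1) by rewrite mulr_ge0 ?addr_ge0 ?mulr_ge0 // ltW.
have [N growth] := classA_growth R a _ _ aA C0 r1.
pose total t := (\sum_(n < N) cfg t n)%N.
(* A configuration is monotone in [t], hence determined by its total. *)
have total_inj s t : T s -> T t -> total s = total t ->
    forall n, (n < N)%N -> cfg s n = cfg t n.
  wlog st : s t / s <= t.
    move=> wl Ts Tt e n nN; have [st|ts] := leP s t; first exact: wl.
    by apply/esym/wl => //; exact: ltW.
  move=> Ts Tt e n nN.
  have [_] := @leqif_sum 'I_N predT (fun i => cfg s i == cfg t i) (cfg s) (cfg t)
    (fun i _ => leqif_eq (cfg_incr i s t Ts Tt st)).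
  rewrite -/(total s) -/(total t) e eqxx => /esym/forallP/(_ (Ordinal nN)).
  by move/eqP.
pose S := (N * Num.truncn (D * a N * q)).+1.
have total_lt t : T t -> (total t < S)%N.
  move=> Tt; rewrite ltnS.
  apply: (@leq_trans (\sum_(n < N) Num.truncn (D * a N * q))); last first.
    by rewrite sum_nat_const card_ord.
  rewrite /total; apply: bigop.leq_sum => n _; rewrite le_truncn // ler_pM2r //.
  have /andP[_ /le_trans] := b_bound n t Tt; apply.
  by rewrite ler_wpM2l // classA_homo // ltnW.
(* One representative sequence per total. Values of [s] that are not attained get an arbitrary
   sequence with the required gaps. *)
have /choice[g gP] (s : nat) : exists gs : nat -> nat,
    (forall n, (gs n + k.+1 <= gs n.+1)%N) /\
    (forall t, T t -> total t = s -> forall n, (n < N)%N -> cfg t n = gs n).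
  have [[t0 [Tt0 <-]]|no] := pselect (exists t, T t /\ total t = s).
    exists (cfg t0); split => [n|t Tt e n nN]; first exact: cfg_gap.
    exact: total_inj.
  exists (fun n => n * k.+1)%N; split => [n|t Tt e].
    by rewrite mulSn addnC.
  by case: no; exists t.
pose c (i : 'I_(k.+1 * l.+1) * 'I_S) n := (i.1 + g i.2 n)%N.
have [||f f_lt f_hit] := exists_hitting_choice _ k N c.
- by move=> i n; rewrite -addnA leq_add2l; exact: (gP i.2).1.
- rewrite card_prod !card_ord -(ltr_nat R) natrM !natrX.
  have kN0 : 0 < k%:R ^+ N :> R by rewrite exprn_gt0 // ltr0n.
  rewrite -ltr_pdivlMr // -expr_div_n (le_lt_trans _ growth) //.
  rewrite natrM -/q -mulrA ler_pM2l // /S -natr1 natrM.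
  have aN0 : 0 <= a N by rewrite (le_trans _ (classA_ge_nat _ _ N aA)).
  have : (Num.truncn (D * a N * q))%:R <= D * a N * q.
    by rewrite truncn_le !mulr_ge0 // ltW.
  move/(ler_wpM2l (ler0n R N)).
  have : 0 <= D * q by rewrite mulr_ge0 // ltW.
  have : 0 <= N%:R * a N by rewrite mulr_ge0.
  lra.
exists f => // x t /andP[mx xm] Tt.
have xq0 : 0 <= (x - m) * q by rewrite mulr_ge0 ?subr_ge0 // ltW.
have xq : (Num.truncn ((x - m) * q) < k.+1 * l.+1)%N.
  rewrite truncn_lt_nat // -/q -[ltRHS]mul1r ltr_pM2r //; lra.
have [n nN] := f_hit (Ordinal xq, Ordinal (total_lt t Tt)).
rewrite /c /= -((gP _).2 t) //; set v := (_ + _)%N => vf.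
(* [v] is a sum of two integer parts, so the point lies in cell [v], which is selected by [vf], or
   in cell [v.+1]. *)
exists n; exists (v %/ k.+1)%N => //=; rewrite -vf -divn_eq in_itv /=.
have xbE : x + b n t = m + ((x - m) * q + b n t * q) / q.
  by rewrite -mulrDl mulfK ?gt_eqF //; lra.
have /andP[lo1 hi1] := truncn_itv xq0.
have /andP[lo2 hi2] := truncn_itv (bq_ge0 n t Tt).
rewrite -/q xbE lerD2l ltrD2l ler_pM2r ?ltr_pM2r ?invr_gt0 // /v -!natr1 natrD.
rewrite -/(cfg t n) -natr1 in hi2; rewrite -/(cfg t n) in lo2.
rewrite -natr1 in hi1.
apply/andP; split; lra.
Qed.

(** The density bound involves only [k] and the gap condition only [l], so [eps] and [c] can be met
    separately. *)
Lemma sparse_hitting_set (R : realType) (a : nat -> R) (b : nat -> R -> R)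
    (T : set R) (D c eps m : R) :
  classA a -> 0 <= D -> 0 < c -> 0 < eps ->
  (forall n t, T t -> 0 <= b n t <= D * a n) ->
  (forall n s t, T s -> T t -> s <= t -> b n s <= b n t) ->
  (forall n t, T t -> c <= b n.+1 t - b n t) ->
  exists F : set R,
    [/\ measurable F,
        forall u, (lebesgue_measure (F `&` [set` `[u, (u + 1)%R]]) <= eps%:E)%E &
        forall x t, m <= x < m + 1 -> T t -> exists n, F (x + b n t)].
Proof.
move=> aA D0 c0 eps0 b_bound b_incr b_gap.
pose k := (Num.truncn (8 / eps)).+1; pose l := Num.truncn c^-1.
have keps : 8 / k.+1%:R <= eps.
  rewrite ler_pdivrMr // mulrC -ler_pdivrMr // ltW //.
  by rewrite (lt_trans (truncnS_gt _)) // ltr_nat.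
have lc : l.+1%:R^-1 <= c.
  by rewrite invf_ple ?posrE // ltW // truncnS_gt.
have [n t Tt|f f_lt f_hit] :=
    hitting_block_cells R a b T D m k l isT aA D0 b_bound b_incr.
  exact: le_trans (b_gap n t Tt).
exists (block_cells k l f m); split => // [|u].
  exact: measurable_block_cells.
by rewrite (le_trans (block_cells_measure _ _ _ _ _ _ f_lt)) // lee_fin.
Qed.

(** * Union over countably many exceptional sets *)

(* "Increasing" is read as non-strict monotonicity.  The booleans b1, b2 range
   over the open/closed choices at the two ends of an interval of length 1. *)
Theorem theorem1p2 (R : realType) (a : nat -> R) (phi : nat -> R -> R)
    (C1 C2 : R)
    (a_classA : classA a)
    (phi_gt0 : forall (n : nat) (t : R), 0 < t -> 0 < phi n t)
    (phi_incr : forall (n : nat) (s t : R),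
        0 < s -> s <= t -> phi n s <= phi n t)
    (C1_gt0 : 0 < C1) (C2_gt0 : 0 < C2)
    (phi_lower : forall (n : nat) (t : R), 0 < t ->
        C1 * t <= phi n.+1 t * a n.+1 - phi n t * a n)
    (phi_upper : forall (n : nat) (t : R), 0 < t -> phi n t <= C2 * t)
    (p : R) (p_ge0 : 0 <= p) (p_lt1 : p < 1) :
  exists E : set R,
    [/\ lebesgue_measurable E,
        (forall (u : R) (b1 b2 : bool),
          (p%:E <= completed_lebesgue_measure
             (E `&` [set` Interval (BSide b1 u) (BSide b2 (u + 1)%R)]))%E) &
        (forall x t : R, 0 < t ->
          ~ ([set x + phi n t * a n | n in [set: nat]] `<=` E))].
Proof.
have a_ge0 n : 0 <= a n by rewrite (le_trans _ (classA_ge_nat _ _ n a_classA)).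
(* These bounds sum to [1 - p]. *)
pose eps i : R := (1 - p) / (2 ^ i.+1)%:R.
have eps_gt0 i : 0 < eps i.
  by rewrite divr_gt0 ?subr_gt0 // ltr0n expn_gt0.
(* These ranges exhaust the positive reals; on each, [phi_upper] and [phi_lower] give bounds uniform
   in [t]. *)
pose T (j : nat) : set R := [set t | j.+1%:R^-1 <= t <= j.+1%:R].
have T_gt0 j t : T j t -> 0 < t.
  by move=> /andP[jt _]; rewrite (lt_le_trans _ jt) // invr_gt0.
(* Pairs [(m, j)] are enumerated by [pickle]; an index that codes no pair gets the empty set. *)
have /choice[F FP] (i : nat) : exists Fi : set R,
    [/\ measurable Fi,
        forall u, (lebesgue_measure (Fi `&` [set` `[u, (u + 1)%R]]) <= (eps i)%:E)%E &
        forall (m : int) (j : nat), pickle (m, j) = i ->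
          forall x t, m%:~R <= x < m%:~R + 1 -> T j t ->
            exists n, Fi (x + phi n t * a n)].
  case: (pselect (exists mj : int * nat, pickle mj = i)) => [[[m j] mj]|no].
    have [|||n t Tt|n s t Ts Tt st|n t Tt|Fi [mF muF hitF]] :=
        @sparse_hitting_set R a (fun n t => phi n t * a n) (T j)
          (C2 * j.+1%:R) (C1 / j.+1%:R) (eps i) m%:~R a_classA.
    - by rewrite mulr_ge0 // ltW.
    - by rewrite divr_gt0.
    - exact: eps_gt0.
    - have t0 := T_gt0 _ _ Tt.
      rewrite mulr_ge0 ?ler_wpM2r //; last by rewrite ltW // phi_gt0.
      rewrite (le_trans (phi_upper n t t0)) // ler_pM2l //.
      by case/andP: Tt.
    - by rewrite ler_wpM2r // phi_incr // (T_gt0 _ _ Ts).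
    - rewrite (le_trans _ (phi_lower n t (T_gt0 _ _ Tt))) // ler_pM2l //.
      by case/andP: Tt.
    exists Fi; split => // m' j'; rewrite -mj => /(pcan_inj pickleK)[-> ->].
    exact: hitF.
  exists set0; split => // [u|m j mj]; last by case: no; exists (m, j).
  by rewrite set0I measure0 lee_fin ltW.
have mF i : measurable (F i) by case: (FP i).
have mUF : measurable (\bigcup_i F i) by exact: bigcupT_measurable.
exists (~` \bigcup_i F i); split.
- by apply: sub_caratheodory; exact: measurableC.
- move=> u b1 b2.
  set I := [set` _]; have mI : measurable I by exact: measurable_itv.
  have muI : lebesgue_measure I = 1%E.
    rewrite lebesgue_measure_itv /= lte_fin ltrDl ltr01 -EFinB.
    by rewrite addrAC subrr add0r.
  have IS : I `<=` [set` `[u, (u + 1)%R]].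
    move=> y; rewrite /I /= !in_itv /= => /andP[/lteifW uy /lteifW yu].
    by rewrite uy yu.
  have muUF : (lebesgue_measure (I `&` \bigcup_i F i) <= (1 - p)%:E)%E.
    apply: (@le_trans _ _ (\sum_(i <oo) lebesgue_measure (I `&` F i))%E).
      apply: (@measure_sigma_subadditive _ _ _ (@lebesgue_measure R)).
      - by move=> i; apply: measurableI (mF i).
      - exact: measurableI.
      - by rewrite setI_bigcupr.
    apply: le_trans (epsilon_trick0 xpredT _); last by rewrite subr_ge0 ltW.
    apply: lee_nneseries => // i _; have [_ muF _] := FP i.
    apply: le_trans (muF u); rewrite setIC le_measure ?inE //.
    - by apply: measurableI => //; exact: mF.
    - by apply: measurableI => //; exact: mF.
    - exact: setIS.
  (* Both measures are given by the same outer measure, so they agree by conversion. *)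
  change (p%:E <= lebesgue_measure (~` (\bigcup_i F i) `&` I))%E.
  rewrite setIC -setDE.
  have muD : (1 = lebesgue_measure (I `\` \bigcup_i F i) +
      lebesgue_measure (I `&` \bigcup_i F i))%E.
    by rewrite -muI; exact: measureDI.
  have -> : p%:E = (1 - (1 - p)%:E)%E by rewrite -EFinB subKr.
  by rewrite leeBlDr // muD leeD2l.
- move=> x t t0 xE.
  (* The sum dominates both terms, so [j.+1] exceeds both [t] and [t^-1]. *)
  pose j := (Num.truncn t + Num.truncn t^-1)%N.
  have Tt : T j t.
    rewrite /T /=; apply/andP; split.
      rewrite invf_ple ?posrE // ltW // (lt_le_trans (truncnS_gt _)) //.
      by rewrite ler_nat ltnS leq_addl.
    rewrite ltW // (lt_le_trans (truncnS_gt _)) //.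
    by rewrite ler_nat ltnS leq_addr.
  have [_ _ /(_ (Num.floor x) j erefl x t)] := FP (pickle (Num.floor x, j)).
  rewrite floor_le -intrD1 floorD1_gt => /(_ isT Tt)[n Fn].
  by apply: (xE (x + phi n t * a n)); [exists n|exists (pickle (Num.floor x, j))].
Qed.
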